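(* Let $A=\mathbf{e_1}A_{\hat 1}+\mathbf{e_2}A_{\hat 2}$ be a bicomplex square matrix. The inverse $A^{-1}$ exists if and only if $A$ is not singular, and then $A^{-1}$ is given by $\mathbf{e_1}(A_{\hat 1})^{-1}+\mathbf{e_2}(A_{\hat 2})^{-1}$.
   Context: Bicomplex numbers: $\mathbb{T}$ is the commutative ring of elements $w=z_1+z_2\mathbf{i_2}$ with $z_1,z_2\in\mathbb{C}(\mathbf{i_1})=\{x+y\mathbf{i_1}: x,y\in\mathbb{R}\}$ (a copy of the complex field), where $\mathbf{i_1}^2=\mathbf{i_2}^2=-1$ and $\mathbf{i_1}\mathbf{i_2}=\mathbf{i_2}\mathbf{i_1}=\mathbf{j}$, so $\mathbf{j}^2=1$. Put $\mathbf{e_1}=(1+\mathbf{j})/2$, $\mathbf{e_2}=(1-\mathbf{j})/2$; then $\mathbf{e_k}^2=\mathbf{e_k}$, $\mathbf{e_1}\mathbf{e_2}=0$, $\mathbf{e_1}+\mathbf{e_2}=1$, and every $w\in\mathbb{T}$ is uniquely $w=\mathbf{e_1}w_{\hat 1}+\mathbf{e_2}w_{\hat 2}$ with $w_{\hat 1},w_{\hat 2}\in\mathbb{C}(\mathbf{i_1})$. The null cone is the set of $w$ with $w_{\hat 1}=0$ or $w_{\hat 2}=0$ (including $w=0$). A bicomplex square matrix $A$ has entries in $\mathbb{T}$; entrywise decomposition gives $A=\mathbf{e_1}A_{\hat 1}+\mathbf{e_2}A_{\hat 2}$ with $A_{\hat k}$ having entries in $\mathbb{C}(\mathbf{i_1})$.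 $A$ is singular if $\det(A)$ is in the null cone. *)

(* Defs.v *)
From HB Require Import structures.
From mathcomp Require Import all_boot all_order all_algebra.
From mathcomp Require Import complex reals ring.
Set Implicit Arguments.
Unset Strict Implicit.
Unset Printing Implicit Defensive.
Import GRing.Theory.
Local Open Scope ring_scope.

(* [Bicomplex z1 z2] stands for z1 + z2 i2, and R[i] is C(i1). *)
Record bicomplex (R : Type) : Type := Bicomplex { bc_z1 : R[i]; bc_z2 : R[i] }.

Definition pair_of_bc (R : Type) (w : bicomplex R) := (bc_z1 w, bc_z2 w).
Definition bc_of_pair (R : Type) (p : R[i] * R[i]) := Bicomplex p.1 p.2.

Lemma pair_of_bcK (R : Type) : cancel (@pair_of_bc R) (@bc_of_pair R).
Proof. by case. Qed.

HB.instance Definition _ (R : eqType) := Equality.copy (bicomplex R)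
  (can_type (@pair_of_bcK R)).
HB.instance Definition _ (R : choiceType) := Choice.copy (bicomplex R)
  (can_type (@pair_of_bcK R)).

Section BicomplexRing.
Variable R : rcfType.
Implicit Types u v w : bicomplex R.

Definition bc_zero : bicomplex R := Bicomplex 0 0.
Definition bc_one : bicomplex R := Bicomplex 1 0.
Definition bc_opp w : bicomplex R := Bicomplex (- bc_z1 w) (- bc_z2 w).
Definition bc_add v w : bicomplex R :=
  Bicomplex (bc_z1 v + bc_z1 w) (bc_z2 v + bc_z2 w).
Definition bc_mul v w : bicomplex R :=
  Bicomplex (bc_z1 v * bc_z1 w - bc_z2 v * bc_z2 w)
            (bc_z1 v * bc_z2 w + bc_z2 v * bc_z1 w).

Fact bc_addA : associative bc_add.
Proof. by move=> u v w; rewrite /bc_add /= !addrA. Qed.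
Fact bc_addC : commutative bc_add.
Proof. by move=> v w; congr Bicomplex; rewrite addrC. Qed.
Fact bc_add0 : left_id bc_zero bc_add.
Proof. by case=> a b; rewrite /bc_add /= !add0r. Qed.
Fact bc_addN : left_inverse bc_zero bc_opp bc_add.
Proof. by case=> a b; rewrite /bc_add /= !addNr. Qed.

HB.instance Definition _ := GRing.isZmodule.Build (bicomplex R)
  bc_addA bc_addC bc_add0 bc_addN.

Fact bc_mulA : associative bc_mul.
Proof. by move=> u v w; congr Bicomplex => /=; ring. Qed.
Fact bc_mulC : commutative bc_mul.
Proof. by move=> v w; congr Bicomplex => /=; ring. Qed.
Fact bc_mul1 : left_id bc_one bc_mul.
Proof. by case=> a b; congr Bicomplex => /=; ring. Qed.
Fact bc_mulD : left_distributive bc_mul bc_add.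
Proof. by move=> u v w; congr Bicomplex => /=; ring. Qed.
Fact bc_one_neq0 : bc_one != bc_zero.
Proof. by apply/eqP => -[] /eqP; rewrite oner_eq0. Qed.

HB.instance Definition _ := GRing.Zmodule_isComNzRing.Build (bicomplex R)
  bc_mulA bc_mulC bc_mul1 bc_mulD bc_one_neq0.

Definition bc_of_complex (z : R[i]) : bicomplex R := Bicomplex z 0.

Definition bc_i1 : bicomplex R := bc_of_complex (Complex 0 1).
Definition bc_i2 : bicomplex R := Bicomplex 0 1.
Definition bc_j : bicomplex R := bc_i1 * bc_i2.
Definition bc_e1 : bicomplex R := bc_of_complex 2^-1 * (1 + bc_j).
Definition bc_e2 : bicomplex R := bc_of_complex 2^-1 * (1 - bc_j).

(* Since i2 e1 = - i1 e1 and i2 e2 = i1 e2, the idempotent components of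
   z1 + z2 i2 are z1 - z2 i1 and z1 + z2 i1; see bc_hat_decomp and
   bc_hat_unique. *)
Definition bc_hat1 w : R[i] := bc_z1 w - bc_z2 w * Complex 0 1.
Definition bc_hat2 w : R[i] := bc_z1 w + bc_z2 w * Complex 0 1.

Definition null_cone w : Prop := bc_hat1 w = 0 \/ bc_hat2 w = 0.

Definition bc_mx_of_complex (n : nat) (M : 'M[R[i]]_n) : 'M[bicomplex R]_n :=
  map_mx bc_of_complex M.
Definition mx_hat1 (n : nat) (A : 'M[bicomplex R]_n) : 'M[R[i]]_n :=
  map_mx bc_hat1 A.
Definition mx_hat2 (n : nat) (A : 'M[bicomplex R]_n) : 'M[R[i]]_n :=
  map_mx bc_hat2 A.

Definition bc_singular (n : nat) (A : 'M[bicomplex R]_n) : Prop :=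
  null_cone (\det A).

Definition is_mx_inverse (n : nat) (A B : 'M[bicomplex R]_n) : Prop :=
  A *m B = 1%:M /\ B *m A = 1%:M.

Lemma sqr_i : (Complex 0 1 : R[i]) * Complex 0 1 = -1.
Proof. by rewrite -expr2 sqr_i. Qed.

Lemma bc_i1_sqr : bc_i1 * bc_i1 = -1.
Proof. by congr Bicomplex; rewrite /= ?sqr_i; ring. Qed.
Lemma bc_i2_sqr : bc_i2 * bc_i2 = -1.
Proof. by congr Bicomplex => /=; ring. Qed.
Lemma bcE w : w = bc_of_complex (bc_z1 w) + bc_of_complex (bc_z2 w) * bc_i2.
Proof. by case: w => a b; congr Bicomplex => /=; ring. Qed.

Lemma half_half : (2^-1 : R[i]) + 2^-1 = 1.
Proof.
have h : (2 : R[i]) != 0 by rewrite Num.Theory.pnatr_eq0.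
by rewrite -mulr2n -[_ *+ 2]mulr_natl divff.
Qed.

Lemma bc_idemE (z1 z2 : R[i]) :
  bc_e1 * bc_of_complex z1 + bc_e2 * bc_of_complex z2 =
  Bicomplex (2^-1 * (z1 + z2)) (2^-1 * Complex 0 1 * (z1 - z2)).
Proof.
rewrite /bc_e1 /bc_e2 /bc_j /bc_i1 /bc_i2 /bc_of_complex.
by congr Bicomplex => /=; set h := (2^-1 : R[i]); ring.
Qed.

Lemma bc_hat_decomp w :
  w = bc_e1 * bc_of_complex (bc_hat1 w) + bc_e2 * bc_of_complex (bc_hat2 w).
Proof.
rewrite bc_idemE; case: w => a b; rewrite /bc_hat1 /bc_hat2 /=.
set i := Complex _ _; have hi : i * i = -1 by exact: sqr_i.
have hh := half_half; set h := (2^-1 : R[i]) in hh *.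
congr Bicomplex.
  transitivity ((h + h) * a); last by ring.
  by rewrite hh mul1r.
transitivity (- (h + h) * (i * i) * b); last by ring.
by rewrite hh hi; ring.
Qed.

Lemma bc_hat_unique (z1 z2 : R[i]) w :
  w = bc_e1 * bc_of_complex z1 + bc_e2 * bc_of_complex z2 ->
  bc_hat1 w = z1 /\ bc_hat2 w = z2.
Proof.
rewrite bc_idemE => ->; rewrite /bc_hat1 /bc_hat2 /=.
set i := Complex _ _; have hi : i * i = -1 by exact: sqr_i.
have hh := half_half; set h := (2^-1 : R[i]) in hh *.
split.
  transitivity (h * (z1 + z2) - h * (i * i) * (z1 - z2)); first by ring.
  by rewrite hi; transitivity ((h + h) * z1); [ring | rewrite hh mul1r].
transitivity (h * (z1 + z2) + h * (i * i) * (z1 - z2)); first by ring.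
by rewrite hi; transitivity ((h + h) * z2); [ring | rewrite hh mul1r].
Qed.

Lemma mx_hat_decomp (n : nat) (A : 'M[bicomplex R]_n) :
  A = bc_e1 *: bc_mx_of_complex (mx_hat1 A)
    + bc_e2 *: bc_mx_of_complex (mx_hat2 A).
Proof. by apply/matrixP => i j; rewrite !mxE; exact: bc_hat_decomp. Qed.

Lemma mx_hat_unique (n : nat) (A : 'M[bicomplex R]_n) (A1 A2 : 'M[R[i]]_n) :
  A = bc_e1 *: bc_mx_of_complex A1 + bc_e2 *: bc_mx_of_complex A2 ->
  mx_hat1 A = A1 /\ mx_hat2 A = A2.
Proof.
move=> eA; split; apply/matrixP => i j; rewrite !mxE.
  have /bc_hat_unique[-> _] // :
    A i j = bc_e1 * bc_of_complex (A1 i j) + bc_e2 * bc_of_complex (A2 i j).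
  by rewrite eA !mxE.
have /bc_hat_unique[_ ->] // :
  A i j = bc_e1 * bc_of_complex (A1 i j) + bc_e2 * bc_of_complex (A2 i j).
by rewrite eA !mxE.
Qed.

End BicomplexRing.

Arguments bc_i1 {R}.
Arguments bc_i2 {R}.
Arguments bc_j {R}.
Arguments bc_e1 {R}.
Arguments bc_e2 {R}.

(* Main.v *)
(* The idempotent components [bc_hat1] and [bc_hat2] are ring morphisms onto
   R[i] which are jointly injective, so they commute with products and
   determinants of matrices: [B] inverts [A] iff each component of [B] inverts
   the corresponding component of [A], and [\det A] avoids the null cone iff
   both components of [A] have a nonzero determinant over the field R[i]. *)
Require Import Defs.
From HB Require Import structures.
From mathcomp Require Import all_boot all_order all_algebra.
From mathcomp Require Import complex reals.
From mathcomp Require Import ring.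
Import GRing.Theory.
Local Open Scope ring_scope.

Section IdempotentComponents.
Variable R : rcfType.

Fact bc_hat1_is_zmod_morphism : zmod_morphism (@bc_hat1 R).
Proof. by move=> v w; rewrite /bc_hat1 /=; ring. Qed.

Fact bc_hat2_is_zmod_morphism : zmod_morphism (@bc_hat2 R).
Proof. by move=> v w; rewrite /bc_hat2 /=; ring. Qed.

(** [bc_hat1] substitutes [- i1] for [i2], and [bc_hat2] substitutes [i1]; both are square roots of
    -1, as [i2] is, so products are respected. *)
Fact bc_hat1_is_monoid_morphism : monoid_morphism (@bc_hat1 R).
Proof.
split=> [|v w]; rewrite /bc_hat1 /=; first by rewrite mul0r subr0.
by have hi := sqr_i R; ring: hi.
Qed.

Fact bc_hat2_is_monoid_morphism : monoid_morphism (@bc_hat2 R).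
Proof.
split=> [|v w]; rewrite /bc_hat2 /=; first by rewrite mul0r addr0.
by have hi := sqr_i R; ring: hi.
Qed.

HB.instance Definition _ := GRing.isZmodMorphism.Build (bicomplex R) R[i]
  (@bc_hat1 R) bc_hat1_is_zmod_morphism.
HB.instance Definition _ := GRing.isMonoidMorphism.Build (bicomplex R) R[i]
  (@bc_hat1 R) bc_hat1_is_monoid_morphism.
HB.instance Definition _ := GRing.isZmodMorphism.Build (bicomplex R) R[i]
  (@bc_hat2 R) bc_hat2_is_zmod_morphism.
HB.instance Definition _ := GRing.isMonoidMorphism.Build (bicomplex R) R[i]
  (@bc_hat2 R) bc_hat2_is_monoid_morphism.

Variable n : nat.
Implicit Types A B : 'M[bicomplex R]_n.

Lemma mx_hat_inj A B :
  mx_hat1 A = mx_hat1 B -> mx_hat2 A = mx_hat2 B -> A = B.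
Proof. by move=> h1 h2; rewrite [A]mx_hat_decomp h1 h2 -mx_hat_decomp. Qed.

Lemma is_mx_inverse_hatP A B :
  is_mx_inverse A B <->
  mx_hat1 A *m mx_hat1 B = 1%:M /\ mx_hat2 A *m mx_hat2 B = 1%:M.
Proof.
rewrite /mx_hat1 /mx_hat2 -!map_mxM; split=> [[-> _]|[h1 h2]].
  by rewrite !map_mx1.
have AB1 : A *m B = 1%:M by apply: mx_hat_inj; rewrite /mx_hat1 /mx_hat2 map_mx1.
(* Over a commutative ring a one-sided inverse of a square matrix is two-sided. *)
by split; last exact: mulmx1C.
Qed.

Lemma not_bc_singularP A :
  ~ bc_singular A <-> mx_hat1 A \in unitmx /\ mx_hat2 A \in unitmx.
Proof.
rewrite !unitmxE !unitfE !det_map_mx; split=> [ns|[/eqP h1 /eqP h2] []//].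
by split; apply/eqP => h; apply: ns; [left | right].
Qed.

(** Cancel [M] on the left. Invertibility is assumed since [invmx M] defaults to [M] when [M] is not
    a unit. *)
Lemma mulmx1_invmxP (F : fieldType) (M N : 'M[F]_n) :
  M \in unitmx -> M *m N = 1%:M <-> N = invmx M.
Proof.
by move=> uM; split=> [MN|->]; rewrite ?mulmxV // -[N](mulKmx uM) MN mulmx1.
Qed.

Lemma is_mx_inverse_invmxP A B :
  mx_hat1 A \in unitmx -> mx_hat2 A \in unitmx ->
  is_mx_inverse A B <->
  B = bc_e1 *: bc_mx_of_complex (invmx (mx_hat1 A))
    + bc_e2 *: bc_mx_of_complex (invmx (mx_hat2 A)).
Proof.
move=> u1 u2; rewrite is_mx_inverse_hatP !mulmx1_invmxP //.
(* Existence of the idempotent decomposition gives one direction, its uniqueness the other. *)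
by split=> [[<- <-]|/mx_hat_unique//]; exact: mx_hat_decomp.
Qed.

End IdempotentComponents.

Theorem theorem3p3 (R : realType) (n : nat) (A : 'M[bicomplex R]_n) :
  ((exists B : 'M[bicomplex R]_n, is_mx_inverse A B) <-> ~ bc_singular A) /\
  (~ bc_singular A ->
     [/\ mx_hat1 A \in unitmx, mx_hat2 A \in unitmx &
         forall B : 'M[bicomplex R]_n,
           is_mx_inverse A B <->
           B = bc_e1 *: bc_mx_of_complex (invmx (mx_hat1 A))
             + bc_e2 *: bc_mx_of_complex (invmx (mx_hat2 A))]).
Proof.
rewrite not_bc_singularP; split; last first.
  by move=> [u1 u2]; split=> // B; exact: is_mx_inverse_invmxP.
split=> [[B /is_mx_inverse_hatP[/mulmx1_unit[u1 _] /mulmx1_unit[u2 _]]] //|].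
(* The witness stays open until the equivalence turns the goal into an equation that determines
   it. *)
by move=> [u1 u2]; eexists; apply/is_mx_inverse_invmxP.
Qed.
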